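(* Let $2\le k<n$ be integers and let $G$ be a rank-1 feature graph on $[n]$ with non-negative edge weights, given by scalar features $f_1,\dots,f_n\in\mathbb{R}_+$ with $w_{ij}=f_if_j$ for $i\ne j$. Let $\mathcal{A}^{\mathrm{ALG}}$ be the partition of $[n]$ returned by the Greedy Feature-Balancing Algorithm on input $f_1,\dots,f_n$ and $k$, let $\mathrm{ALG}:=\operatorname{Cut}(\mathcal{A}^{\mathrm{ALG}})$, and let $\mathrm{OPT}$ be the optimal Max-$k$-Cut value of $G$. Then $$\mathrm{OPT}-\mathrm{ALG}\ \le\ \frac{1}{50}\,\Phi(\mathcal{A}^{\mathrm{ALG}}).$$ If, in addition, there exists a perfect feature balanced partition of $[n]$, i.e. a partition $(A_1,\dots,A_k)$ with $\sum_{i\in A_1}f_i=\cdots=\sum_{i\in A_k}f_i$, then $$\mathrm{OPT}-\mathrm{ALG}\ \le\ \frac{1}{74}\,\Phi(\mathcal{A}^{\mathrm{ALG}}).$$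
   Context: $[n]=\{1,\dots,n\}$ and $\mathbb{R}_+$ denotes the non-negative reals. A rank-1 feature graph is a weighted graph on $[n]$ whose weights can be written as $w_{ij}=f_if_j$ for all $i\ne j$ with real scalars $f_1,\dots,f_n$ (with $w_{ij}=0$ for non-edges). For a partition $\mathcal{A}=(A_1,\dots,A_k)$ of $[n]$ into $k$ disjoint (possibly empty) parts, $$\operatorname{Cut}(\mathcal{A})=\sum_{\ell<m}\sum_{i\in A_\ell,\,j\in A_m}w_{ij},\qquad \Phi(\mathcal{A})=\sum_{\ell=1}^k\Big(\sum_{i\in A_\ell}f_i\Big)^2.$$ Max-$k$-Cut asks to maximize $\operatorname{Cut}$ over all such partitions. Greedy Feature-Balancing Algorithm for scalar features: choose an ordering $(v_1,\dots,v_n)$ of $[n]$ with $|f_{v_1}|\ge\cdots\ge|f_{v_n}|$ (ties broken arbitrarily). Start with $A_1=\cdots=A_k=\emptyset$ and $s_1=\cdots=s_k=0$. For $t=1,\dots,n$: let $v=v_t$; choose $\ell^\star\in\arg\min_{\ell\in[k]}f_vs_\ell$ (ties broken arbitrarily); replace $A_{\ell^\star}$ by $A_{\ell^\star}\cup\{v\}$ and $s_{\ell^\star}$ by $s_{\ell^\star}+f_v$. Return $(A_1,\dots,A_k)$. *)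

(* Defs.v *)
From mathcomp Require Import all_boot all_order all_algebra.
From mathcomp Require Import reals.

Set Implicit Arguments.
Unset Strict Implicit.
Unset Printing Implicit Defensive.

Import Order.TTheory GRing.Theory Num.Theory.
Local Open Scope ring_scope.

(* The vertex set [n] is 'I_n.  Weighted graphs are given by their weight
   matrices, a non-edge having weight 0; diagonal entries are irrelevant. *)
Definition rank1_feature_graph (R : realType) (n : nat)
    (w : 'M[R]_n) (f : 'I_n -> R) : Prop :=
  forall i j : 'I_n, i != j -> w i j = f i * f j.

Definition parts (n k : nat) : predArgType := {ffun 'I_k -> {set 'I_n}}.

Definition kpartition (n k : nat) (A : parts n k) : bool :=
  [forall l, forall m, (l != m) ==> [disjoint A l & A m]]
  && (\bigcup_(l < k) A l == [set: 'I_n]).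

Definition cut (R : realType) (n k : nat) (w : 'M[R]_n) (A : parts n k) : R :=
  \sum_(l < k) \sum_(m < k | (l < m)%N) \sum_(i in A l) \sum_(j in A m) w i j.

(* For k > 0 the default value 0 does not affect the maximum: it is the cut
   value of the partition ([n], set0, ..., set0). *)
Definition max_kcut (R : realType) (n : nat) (k : nat) (w : 'M[R]_n) : R :=
  \big[Num.max/0]_(A : parts n k | kpartition A) cut w A.

Definition Phi (R : realType) (n k : nat) (f : 'I_n -> R) (A : parts n k) : R :=
  \sum_(l < k) (\sum_(i in A l) f i) ^+ 2.

Definition perfectly_balanced (R : realType) (n k : nat)
    (f : 'I_n -> R) (A : parts n k) : Prop :=
  kpartition A /\
  forall l m : 'I_k, \sum_(i in A l) f i = \sum_(i in A m) f i.

(* The current parts A_l together with the running sums s_l. *)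
Definition greedy_state (R : realType) (n k : nat) : Type :=
  (parts n k * {ffun 'I_k -> R})%type.

Definition greedy_init (R : realType) (n k : nat) : greedy_state R n k :=
  ([ffun=> set0], [ffun=> 0]).

Definition greedy_update (R : realType) (n k : nat) (f : 'I_n -> R)
    (v : 'I_n) (l : 'I_k) (st : greedy_state R n k) : greedy_state R n k :=
  ([ffun m => if m == l then v |: st.1 m else st.1 m],
   [ffun m => if m == l then st.2 m + f v else st.2 m]).

(* A relation rather than a function: any minimizing part may be chosen. *)
Inductive greedy_run (R : realType) (n k : nat) (f : 'I_n -> R) :
    seq 'I_n -> greedy_state R n k -> greedy_state R n k -> Prop :=
| greedy_run_nil (st : greedy_state R n k) : greedy_run f [::] st st
| greedy_run_cons v vs (l : 'I_k) (st st' : greedy_state R n k) :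
    (forall m : 'I_k, f v * st.2 l <= f v * st.2 m) ->
    greedy_run f vs (greedy_update f v l st) st' ->
    greedy_run f (v :: vs) st st'.

Definition greedy_ordering (R : realType) (n : nat) (f : 'I_n -> R)
    (vs : seq 'I_n) : bool :=
  perm_eq vs (enum 'I_n) && sorted (fun i j => `|f j| <= `|f i|) vs.

(* A is a possible output, for some resolution of all ties. *)
Definition greedy_output (R : realType) (n k : nat) (f : 'I_n -> R)
    (A : parts n k) : Prop :=
  exists (vs : seq 'I_n) (s : {ffun 'I_k -> R}),
    greedy_ordering f vs /\ greedy_run f vs (greedy_init R n k) (A, s).

(* Main.v *)
Require Import Defs.
From mathcomp Require Import all_boot all_order all_algebra.
From mathcomp Require Import reals zify ring lra.

(* Since 2 Cut = (sum f)^2 - Phi, the claims say that the sum of squared loads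
   of a list schedule in decreasing order is at most 25/24 times that of any
   other schedule, and 37/36 times when a schedule with equal loads exists.

   Let L be the least greedy load. A part of greedy load above 3L/2 contains
   only jobs larger than L/2; such big jobs are folded, at most two per part,
   which by exchange minimizes the sum of G(load) for every convex G. Take
   G(x) = max(x - mu, 0)^2, where mu is the average of the loads at most 3L/2:
   then (y - mu)^2 >= G(b) for a part of load y and big load b, which bounds any
   schedule from below by the squares of the overfull parts plus mu^2 for each
   other part. The loads lying in [L, 3L/2] have mean square at most
   (25/24) mu^2.

   If all loads can be made equal to C, Graham's argument shows that jobs larger
   than C/3 never make a part exceed C. Hence all greedy loads lie in [L, M],
   M = max(C, L + C/3), and their variance is at most
   (C - L)(M - C) <= C^2/36. *)

Set Implicit Arguments.
Unset Strict Implicit.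
Unset Printing Implicit Defensive.

Import Order.TTheory GRing.Theory Num.Theory.
Local Open Scope ring_scope.

(** * Loads, and greedy runs as assignments of jobs to parts *)

Definition load (R : realFieldType) (n k : nat) (f : 'I_n -> R)
    (g : 'I_n -> 'I_k) (u : seq 'I_n) (l : 'I_k) : R :=
  \sum_(j <- u | g j == l) f j.

(* Zero features are exempt: the algorithm may put them in any part. *)
Definition list_scheduled (R : realFieldType) (n k : nat) (f : 'I_n -> R)
    (g : 'I_n -> 'I_k) (vs : seq 'I_n) : Prop :=
  forall vs1 v vs2 m, vs = vs1 ++ v :: vs2 -> 0 < f v ->
    load f g vs1 (g v) <= load f g vs1 m.

Lemma load_rcons (R : realFieldType) (n k : nat) (f : 'I_n -> R)
    (g : 'I_n -> 'I_k) (u : seq 'I_n) (v : 'I_n) (l : 'I_k) :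
  load f g (rcons u v) l = load f g u l + (if g v == l then f v else 0).
Proof.
by rewrite /load -cats1 big_cat /= big_cons big_nil; case: ifP; rewrite ?addr0.
Qed.

Lemma load_ge0 (R : realFieldType) (n k : nat) (f : 'I_n -> R)
    (g : 'I_n -> 'I_k) (u : seq 'I_n) (l : 'I_k) :
  (forall i, 0 <= f i) -> 0 <= load f g u l.
Proof. by move=> f0; apply: sumr_ge0. Qed.

Lemma load_cat (R : realFieldType) (n k : nat) (f : 'I_n -> R)
    (g : 'I_n -> 'I_k) (u v : seq 'I_n) (l : 'I_k) :
  load f g (u ++ v) l = load f g u l + load f g v l.
Proof. by rewrite /load big_cat. Qed.

(** The arbitrary starting state makes the induction on the run work: a running sum is its starting
    value plus the load placed since. [l0] gives [g] a value on vertices outside [vs]. *)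
Lemma greedy_run_assignment (R : realType) (n k : nat) (l0 : 'I_k)
    (f : 'I_n -> R) (vs : seq 'I_n) (st st' : greedy_state R n k) :
  greedy_run f vs st st' -> uniq vs ->
  exists g : 'I_n -> 'I_k,
    (forall l j, (j \in st'.1 l) = (j \in st.1 l) || (j \in vs) && (g j == l))
    /\ (forall vs1 v vs2 m, vs = vs1 ++ v :: vs2 ->
        f v * (st.2 (g v) + load f g vs1 (g v)) <=
        f v * (st.2 m + load f g vs1 m)).
Proof.
elim=> [{}st|v {}vs l {}st {}st' hmin _ IH] /=.
  by move=> _; exists (fun=> l0); split=> [l j|[|? ?] //]; rewrite orbF.
move=> /andP[v_vs /IH[g [gA gs]]].
pose g' j := if j == v then l else g j.
have load_g' u m : v \notin u -> load f g' u m = load f g u m.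
  move=> vu; rewrite /load big_seq_cond [RHS]big_seq_cond.
  apply: eq_bigl => j; rewrite /g'.
  by have [->|//] := eqVneq j v; rewrite (negPf vu).
exists g'; split=> [m j|vs1 x vs2 m].
  rewrite gA ffunE in_cons /g'.
  have [->|jv] := eqVneq j v.
    rewrite (negPf v_vs) /= orbF eq_sym; case: eqVneq => // _.
      by rewrite in_setU1 eqxx orbT.
    by rewrite orbF.
  by case: (m == l); rewrite // in_setU1 (negPf jv).
case: vs1 => [[<- _]|y vs1 [<- vsE]].
  by rewrite /load !big_nil !addr0 /g' eqxx.
have vs1v : v \notin vs1.
  by apply: contra v_vs; rewrite vsE mem_cat => ->.
have xv : x != v.
  by apply: contraNneq v_vs => <-; rewrite vsE mem_cat mem_head orbT.
have lc p : load f g' (v :: vs1) p =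
    (if l == p then f v else 0) + load f g vs1 p.
  rewrite -load_g' // /load big_cons {1}/g' eqxx.
  by case: ifP => //; rewrite add0r.
have g'x : g' x = g x by rewrite /g' (negPf xv).
rewrite !lc g'x; have := gs _ _ _ m vsE.
rewrite !ffunE /= ![_ == l]eq_sym.
by case: (l == m); case: (l == g x); rewrite ?add0r ?addrA.
Qed.

(** For non-negative features the order by absolute value is the order by size, and a positive [f v]
    cancels from the selection rule. *)
Lemma greedy_output_assignment (R : realType) (n k : nat) (l0 : 'I_k)
    (f : 'I_n -> R) (A : parts n k) :
  (forall i, 0 <= f i) -> greedy_output f A ->
  exists (vs : seq 'I_n) (g : 'I_n -> 'I_k),
    [/\ perm_eq vs (enum 'I_n), pairwise (fun i j => f j <= f i) vs,
        list_scheduled f g vs & forall l j, (j \in A l) = (g j == l)].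
Proof.
move=> f0 [vs [s [/andP[vsP vs_sorted] run]]].
have vsU : uniq vs by rewrite (perm_uniq vsP) enum_uniq.
have [g [gA gs]] := greedy_run_assignment l0 run vsU.
exists vs, g; split=> //.
- have : sorted (fun i j => f j <= f i) vs.
    by apply: sub_sorted vs_sorted => i j /=; rewrite !ger0_norm.
  by rewrite sorted_pairwise // => y x z yx zy; exact: le_trans zy yx.
- move=> vs1 v vs2 m vsE fv; have := gs vs1 v vs2 m vsE.
  by rewrite !ffunE !add0r ler_pM2l.
- move=> l j; rewrite gA ffunE in_set0 /=.
  by rewrite (perm_mem vsP) mem_enum.
Qed.

(** * Convex costs and the optimality of folding *)

(** Convexity as growth of increments, the form used by exchanges: of two pairs of loads with equal
    sum, the more spread one costs at least as much. *)
Definition spread_convex (R : realFieldType) (G : R -> R) : Prop :=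
  forall x u v, 0 <= u -> 0 <= v -> G (x + u) + G (x + v) <= G x + G (x + u + v).

Lemma spread_convex_pos_sqr (R : realFieldType) (mu : R) :
  spread_convex (fun x => Num.max (x - mu) 0 ^+ 2).
Proof.
move=> x u v u0 v0 /=.
rewrite /Num.max; do !case: ifP; move=> *; nra.
Qed.

(** Unless all lists have two jobs, one has at least three and another at most one. Moving a job
    from the former to the latter does not raise the cost: the donor keeps two big jobs, weighing at
    least [L], and the receiver weighed at most [L]. *)
Lemma balance_big_lists (R : realFieldType) (G : R -> R) (L : R)
    (tau : seq (seq R)) :
  spread_convex G -> 0 <= L ->
  {in flatten tau, forall x, L / 2 < x <= L} ->
  size (flatten tau) = (2 * size tau)%N ->
  exists tau', [/\ perm_eq (flatten tau') (flatten tau), size tau' = size tau,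
    {in tau', forall c, size c = 2} &
    \sum_(c <- tau') G (\sum_(x <- c) x) <= \sum_(c <- tau) G (\sum_(x <- c) x)].
Proof.
move=> cvx L0.
(* With truncated subtraction this is the total excess over two jobs per list; each move lowers it
   by one. *)
have [N] := ubnP (\sum_(c <- tau) (size c - 2))%N.
elim: N tau => // N IH tau; rewrite ltnS => tauN tauL tau_size.
have sz (s : seq (seq R)) : size (flatten s) = (\sum_(c <- s) size c)%N.
  by rewrite size_flatten /shape sumnE big_map.
have [/hasP[Y Ytau Y3]|no3] := boolP (has (fun c => 2 < size c)%N tau); last first.
  exists tau; split => // c ctau; apply/eqP; rewrite eqn_leq.
  have le2 : {in tau, forall c, size c <= 2}%N.
    by move=> d dtau; rewrite leqNgt; apply: contra no3 => d3; apply/hasP; exists d.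
  rewrite le2 //= leqNgt; apply/negP => c2.
  have : (size (flatten tau) < 2 * size tau)%N.
    rewrite sz (perm_big _ (perm_to_rem ctau)) /= big_cons.
    have -> : size tau = (size (rem c tau)).+1.
      by rewrite size_rem // prednK //; case: (tau) ctau.
    have : (\sum_(j <- rem c tau) size j <= 2 * size (rem c tau))%N.
      rewrite mulnC -sum1_size big_distrl /= big_seq [leqRHS]big_seq.
      by apply: leq_sum => j /mem_rem jt; rewrite mul1n le2.
    by rewrite mulnS => h; rewrite -addSn leq_add.
  by rewrite tau_size ltnn.
set t1 := rem Y tau; have p1 : perm_eq tau (Y :: t1) by exact: perm_to_rem.
have [/hasP[U Ut1 U1]|no1] := boolP (has (fun c => size c < 2)%N t1); last first.
  have : (2 * size tau < size (flatten tau))%N.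
    rewrite sz (perm_big _ p1) (perm_size p1) /= big_cons mulnS -addSn leq_add //.
    rewrite mulnC -sum1_size big_distrl /= big_seq [leqRHS]big_seq.
    apply: leq_sum => j jt; rewrite mul1n leqNgt.
    by apply: contra no1 => j1; apply/hasP; exists j.
  by rewrite tau_size ltnn.
have [t2 p2] : exists t2, perm_eq tau (Y :: U :: t2).
  by exists (rem U t1); rewrite (perm_trans p1) // perm_cons perm_to_rem.
case: Y Y3 p2 {Ytau t1 p1 Ut1} => // d Y Y2 p2.
pose tau1 := Y :: (d :: U) :: t2.
have pf : perm_eq (flatten tau1) (flatten tau).
  apply: (@perm_trans _ (flatten ((d :: Y) :: U :: t2))); last first.
    by rewrite perm_flatten // perm_sym.
  by apply/permP => a; rewrite /tau1 /= !count_cat /= !count_cat addnCA.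
have size1 : size tau1 = size tau by rewrite (perm_size p2).
have [] := IH tau1.
- apply: leq_trans tauN; rewrite (perm_big _ p2) /tau1 /= !big_cons /=.
  rewrite addnA [ltnRHS]addnA ltn_add2r; move: Y2 U1 => /=.
  by move: (size Y) (size U) => y u; lia.
- by move=> x; rewrite (perm_mem pf); exact: tauL.
- by rewrite (perm_size pf) size1.
move=> tau' [h1 h2 h3 h4]; exists tau'; split=> //.
- exact: perm_trans h1 pf.
- by rewrite h2.
apply: le_trans h4 _; rewrite (perm_big _ p2) /= !big_cons !addrA lerD2r.
have inL : {in (d :: Y) ++ U, forall x, L / 2 < x <= L}.
  move=> x xin; apply: tauL; rewrite -(perm_mem pf) /= mem_cat inE mem_cat.
  by move: xin; rewrite mem_cat inE -orbA; case/or3P=> ->; rewrite ?orbT.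
have UL : 0 <= \sum_(x <- U) x <= L.
  case: U U1 inL {p2 tau1 pf size1 h1 h2} => [|x [|//]] _ inL.
    by rewrite big_nil lexx.
  rewrite big_seq1; have := inL x; rewrite mem_cat mem_head orbT => /(_ isT).
  by move: L0; lra.
have YL : L <= \sum_(x <- Y) x.
  case: Y Y2 inL {p2 tau1 pf size1 h1 h2} => [|x [|y Y]] //= _ inL.
  have hx := inL x; rewrite !inE eqxx orbT in hx.
  have hy := inL y; rewrite !inE eqxx !orbT in hy.
  rewrite !big_cons; suff : 0 <= \sum_(j <- Y) j.
    by move: (hx isT) (hy isT); lra.
  rewrite big_seq; apply: sumr_ge0 => j jY.
  have hj := inL j; rewrite !inE mem_cat jY !orbT in hj.
  by move: (hj isT) L0; lra.
have d0 : 0 <= d by have := inL d; rewrite mem_head => /(_ isT); move: L0; lra.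
set u := \sum_(x <- U) x in UL *; set y := \sum_(x <- Y) x in YL *.
have yu : 0 <= y - u by move: UL YL; lra.
have := cvx u (y - u) d yu d0.
by rewrite subrKC [u + d]addrC [y + d]addrC [G u + _]addrC.
Qed.

(* A part holding at most two big jobs is encoded by the pair of their sizes,
   the larger one first, padded with zeros. *)
Definition big_pair (R : realFieldType) (L : R) (c : R * R) : bool :=
  (c.2 == 0) && (0 <= c.1) || [&& L / 2 < c.2, c.2 <= c.1 & c.1 <= L].

(** Nesting of the intervals from smaller to larger job, a lone job reaching down to 0. The pairs of
    a folded schedule form a chain for it. *)
Definition encloses (R : realFieldType) (c d : R * R) : bool :=
  (d.1 <= c.1) && (c.2 <= d.2).

Definition nonzero_entries (R : realFieldType) (c : R * R) : seq R :=
  [seq x <- [:: c.1; c.2] | x != 0].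

Definition pair_jobs (R : realFieldType) (sigma : seq (R * R)) : seq R :=
  flatten (map (@nonzero_entries R) sigma).

Lemma size_pair_jobs (R : realFieldType) (sigma : seq (R * R)) :
  (size (pair_jobs sigma) <= 2 * size sigma)%N.
Proof.
elim: sigma => // c sigma IH; rewrite /pair_jobs /= size_cat mulnS leq_add //.
by rewrite size_filter /=; case: (_ != 0); case: (_ != 0).
Qed.

Lemma perm_flatten_member (T : eqType) (tau : seq (seq T)) (x : T) :
  x \in flatten tau ->
  exists X tau1 Y, [/\ perm_eq tau (Y :: tau1), perm_eq Y (x :: X) &
    perm_eq (flatten tau) (x :: X ++ flatten tau1)].
Proof.
case/flattenP=> Y Ytau xY; exists (rem x Y), (rem Y tau), Y.
have hY : perm_eq Y (x :: rem x Y) by exact: perm_to_rem.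
have ht : perm_eq tau (Y :: rem Y tau) by exact: perm_to_rem.
by split; rewrite // (perm_trans (perm_flatten ht)) //= -cat_cons perm_cat2r.
Qed.

(** Induction from the outermost pair [(p, q)] inwards: counting padding, [p] is a largest and [q] a
    smallest job. Exchanges that do not raise the cost unite them in one list of [tau], which is
    then dropped. *)
Lemma fold_optimal (R : realFieldType) (G : R -> R) (L : R)
    (sigma : seq (R * R)) (tau : seq (seq R)) :
  spread_convex G -> 0 <= L ->
  all (big_pair L) sigma -> pairwise (@encloses R) sigma ->
  size tau = size sigma -> perm_eq (flatten tau) (pair_jobs sigma) ->
  \sum_(c <- sigma) G (c.1 + c.2) <= \sum_(c <- tau) G (\sum_(x <- c) x).
Proof.
move=> cvx L0.
elim: sigma tau => [|[p q] sigma IH] tau.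
  by move=> _ _ /size0nil ->; rewrite !big_nil.
move=> /= /andP[pq_big sigma_big] /andP[/allP pq_out sigma_pw] tau_size tau_perm.
rewrite big_cons /=.
have [q0|q0] := eqVneq q 0.
  subst q; have p0 : 0 <= p.
    by move: pq_big; rewrite /big_pair /= eqxx; move: L0; lra.
  have sigma_le x : x \in pair_jobs sigma -> 0 <= x <= p.
    case/flattenP=> s /mapP[c cs ->]; rewrite mem_filter !inE => /andP[_].
    have := pq_out _ cs; have := allP sigma_big _ cs; rewrite /encloses /big_pair /=.
    by move=> h1 h2 h3; case/orP: h3 => /eqP ->; move: h1 h2 L0; lra.
  have [p00|p_neq0] := eqVneq p 0.
    have jobs0 : pair_jobs sigma = [::].
      case E : (pair_jobs sigma) => [//|x s].
      have : x \in pair_jobs sigma by rewrite E mem_head.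
      move=> xs; have := sigma_le _ xs; rewrite p00.
      case/flattenP: xs => r /mapP[c _ ->]; rewrite mem_filter => /andP[x0 _].
      by rewrite -eq_le eq_sym (negPf x0).
    case: tau tau_size tau_perm => // t tau [tau_size].
    have -> : pair_jobs ((p, 0) :: sigma) = [::].
      by rewrite -jobs0 /pair_jobs /= /nonzero_entries /= p00 eqxx.
    move/perm_size/size0nil => /= /(congr1 size) /eqP.
    rewrite size_cat addn_eq0 !size_eq0 => /andP[/eqP -> /eqP tau0].
    rewrite big_cons big_nil p00 add0r lerD2l.
    by apply: IH => //; rewrite tau0 jobs0.
  have : p \in flatten tau.
    by rewrite (perm_mem tau_perm) /pair_jobs /= /nonzero_entries /= p_neq0 mem_head.
  case/perm_flatten_member=> X [tau1 [Y [tauY YX ftau]]].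
  rewrite (perm_big _ tauY) /= big_cons (perm_big _ YX) /= big_cons.
  have X_perm : perm_eq (X ++ flatten tau1) (pair_jobs sigma).
    move: tau_perm; rewrite /pair_jobs /= /nonzero_entries /= p_neq0 eqxx /= => h.
    by rewrite -(perm_cons p) (perm_trans _ h) // perm_sym.
  have size1 : size tau1 = size sigma.
    by move: tau_size; rewrite (perm_size tauY) /= => -[].
  have X_ge0 : 0 <= \sum_(x <- X) x.
    rewrite big_seq; apply: sumr_ge0 => x xX.
    suff /sigma_le/andP[] : x \in pair_jobs sigma by [].
    by rewrite -(perm_mem X_perm) mem_cat xX.
  (* The companions [X] of [p] move to a list [U] of at most one job, whose sum is at most [p]. If
     all other lists have two jobs or more, counting shows that [X] is empty. *)
  have [/hasP[U Ut1 U1]|no1] := boolP (has (fun c => size c < 2)%N tau1).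
    have p2 : perm_eq tau1 (U :: rem U tau1) by exact: perm_to_rem.
    have sz : size ((X ++ U) :: rem U tau1) = size sigma.
      by rewrite -size1 (perm_size p2).
    have pe : perm_eq ((X ++ U) ++ flatten (rem U tau1)) (pair_jobs sigma).
      rewrite (perm_trans _ X_perm) // -catA perm_cat2l perm_sym.
      exact: (perm_flatten p2).
    have := IH _ sigma_big sigma_pw sz pe; rewrite big_cons big_cat /=
      (perm_big _ p2) /= big_cons addr0.
    set x := \sum_(j <- X) j; set u := \sum_(j <- U) j => h.
    have up : 0 <= u <= p.
      rewrite /u; case: (U) U1 pe => [|y [|//]] _ pe; first by rewrite big_nil lexx.
      rewrite big_seq1; apply: sigma_le; rewrite -(perm_mem pe) !mem_cat.
      by rewrite mem_head orbT.
    have pu : 0 <= p - u by lra.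
    have := cvx u (p - u) x pu X_ge0; rewrite subrKC [u + x]addrC.
    by move: h; lra.
  have X0 : X = [::].
    apply: size0nil; apply/eqP; rewrite -leqn0.
    have := size_pair_jobs sigma; rewrite -(perm_size X_perm) size_cat -size1.
    have : (2 * size tau1 <= size (flatten tau1))%N.
      rewrite size_flatten /shape sumnE big_map mulnC -sum1_size big_distrl /=.
      rewrite big_seq [leqRHS]big_seq.
      apply: leq_sum => j jt; rewrite mul1n leqNgt.
      by apply: contra no1 => j1; apply/hasP; exists j.
    by lia.
  by rewrite X0 big_nil lerD2l; apply: IH; rewrite // (perm_trans _ X_perm) // X0.
have pqL : [&& L / 2 < q, q <= p & p <= L].
  by move: pq_big; rewrite /big_pair /= (negPf q0).
(* As [q] is big and smallest, no pair of [sigma] is padded. So there are exactly twice as many jobs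
   as lists, and [tau] may be taken to consist of lists of two. *)
have sigma_in c : c \in sigma ->
    [/\ L / 2 < c.1 <= L, L / 2 < c.2 <= L, c.1 <= p, q <= c.1 & q <= c.2].
  move=> cs; have := pq_out _ cs; have := allP sigma_big _ cs.
  rewrite /encloses /big_pair /=; case: (eqVneq c.2 0) => [->|_] /=; move: pqL L0.
    by move=> ? ? ? ?; split; lra.
  by move=> ? ? ? ?; split; lra.
have jobs_in x : x \in pair_jobs sigma -> [/\ L / 2 < x <= L, x <= p & q <= x].
  case/flattenP=> s /mapP[c cs ->]; rewrite mem_filter !inE => /andP[_].
  have := allP sigma_big _ cs.
  have [h1 h2 h3 h4 h5] := sigma_in _ cs; rewrite /big_pair.
  by move=> h6 /orP[] /eqP ->; split; move: h1 h2 h3 h4 h5 h6 pqL L0; lra.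
have ne0 x : L / 2 < x <= L -> x != 0.
  by move=> h; apply: contraTneq h => ->; move: L0; lra.
have jobsE : pair_jobs ((p, q) :: sigma) = [:: p, q & pair_jobs sigma].
  by rewrite /pair_jobs /= /nonzero_entries /= q0 ne0 //; move: pqL; lra.
rewrite jobsE in tau_perm.
have size_jobs : size (pair_jobs sigma) = (2 * size sigma)%N.
  elim: (sigma) sigma_in => // c s IHs s_in.
  rewrite /pair_jobs /= size_cat mulnS; congr (_ + _)%N.
    have [h1 h2 _ _ _] := s_in _ (mem_head _ _).
    by rewrite /nonzero_entries /= !ne0.
  by apply: IHs => d ds; apply: s_in; rewrite in_cons ds orbT.
have [||tau' [tau'_perm tau'_size tau'2 tau'_le]] :=
    @balance_big_lists _ G L tau cvx L0.
- move=> x; rewrite (perm_mem tau_perm) !inE => /or3P[/eqP->|/eqP->|].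
  + by move: pqL L0; lra.
  + by move: pqL L0; lra.
  + by case/jobs_in.
- by rewrite (perm_size tau_perm) /= size_jobs tau_size mulnS.
apply: le_trans tau'_le.
have {tau_perm} := perm_trans tau'_perm tau_perm.
have {tau_size} := etrans tau'_size tau_size.
move: {tau tau'_size tau'_perm} tau' tau'2 => tau tau2 tau_size tau_perm.
have : p \in flatten tau by rewrite (perm_mem tau_perm) mem_head.
case/perm_flatten_member=> X [tau1 [Y [tauY YX ftau]]].
have : size Y = 2 by apply: tau2; rewrite (perm_mem tauY) mem_head.
rewrite (perm_size YX) => -[].
case: X YX ftau => [|x [|//]] // YX ftau _.
have size1 : size tau1 = size sigma.
  by move: tau_size; rewrite (perm_size tauY) /= => -[].
have x_perm : perm_eq (x :: flatten tau1) (q :: pair_jobs sigma).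
  by rewrite -(perm_cons p) (perm_trans _ tau_perm) // perm_sym.
rewrite (perm_big _ tauY) /= big_cons (perm_big _ YX) /= big_cons big_seq1.
have [xq|xq] := eqVneq x q.
  by subst x; rewrite perm_cons in x_perm; rewrite lerD2l; exact: IH.
have : q \in flatten tau1.
  by have := mem_head q (pair_jobs sigma);
    rewrite -(perm_mem x_perm) inE eq_sym (negPf xq).
case/perm_flatten_member=> Z [tau3 [W [tauW WZ ftau1]]].
have : size W = 2.
  by apply: tau2; rewrite (perm_mem tauY) inE (perm_mem tauW) mem_head orbT.
rewrite (perm_size WZ) => -[].
case: Z WZ ftau1 => [|z [|//]] // WZ ftau1 _.
rewrite (perm_big _ tauW) /= big_cons (perm_big _ WZ) /= big_cons big_seq1.
have xz_perm : perm_eq [:: x, z & flatten tau3] (pair_jobs sigma).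
  rewrite -(perm_cons q) (perm_trans _ x_perm) //.
  rewrite (perm_trans (y := x :: q :: z :: flatten tau3)) //.
    by apply/permP => a /=; rewrite addnCA.
  by rewrite perm_cons perm_sym.
(* The lists [p, x] and [q, z] become [p, q] and [x, z], whose sums lie between [q + z] and
   [p + x]. *)
have := IH ([:: x; z] :: tau3) sigma_big sigma_pw.
rewrite /= => /(_ _ xz_perm).
rewrite -size1 (perm_size tauW) /= => /(_ erefl); rewrite big_cons big_cons big_seq1.
have [_ xp qx] : [/\ L / 2 < x <= L, x <= p & q <= x].
  by apply: jobs_in; rewrite -(perm_mem xz_perm) mem_head.
have [_ zp qz] : [/\ L / 2 < z <= L, z <= p & q <= z].
  by apply: jobs_in; rewrite -(perm_mem xz_perm) !inE eqxx orbT.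
have pz : 0 <= p - z by lra.
have qx0 : 0 <= x - q by lra.
have := cvx (q + z) (p - z) (x - q) pz qx0.
have -> : q + z + (p - z) = p + q by lra.
have -> : q + z + (x - q) = x + z by lra.
have -> : p + q + (x - q) = p + x by lra.
by lra.
Qed.

(** * List schedules fold their big jobs *)

Lemma sum_nonzero_entries (R : realFieldType) (c : R * R) :
  \sum_(x <- nonzero_entries c) x = c.1 + c.2.
Proof.
rewrite /nonzero_entries /=.
by have [->|_] := eqVneq c.1 0; have [->|_] := eqVneq c.2 0;
  rewrite !(big_cons, big_nil) ?addr0 ?add0r.
Qed.

Lemma sum_part_sizes (R : realFieldType) (n k : nat) (f : 'I_n -> R)
    (g : 'I_n -> 'I_k) (u : seq 'I_n) (l : 'I_k) :
  \sum_(x <- [seq f j | j <- u & g j == l]) x = load f g u l.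
Proof. by rewrite big_map big_filter. Qed.

Lemma list_scheduled_prefix (R : realFieldType) (n k : nat) (f : 'I_n -> R)
    (g : 'I_n -> 'I_k) (u v : seq 'I_n) :
  list_scheduled f g (u ++ v) -> list_scheduled f g u.
Proof.
by move=> h vs1 x vs2 m uE; apply: (h vs1 x (vs2 ++ v)); rewrite uE -catA.
Qed.

(* The big jobs are folded: with the jobs sorted decreasingly and padded with
   zeros to [2 k] of them, the [i]-th largest is paired with the [i]-th smallest. *)
Lemma big_jobs_folded (R : realFieldType) (n k : nat) (f : 'I_n -> R)
    (g : 'I_n -> 'I_k) (L : R) (u : seq 'I_n) :
  0 <= L -> list_scheduled f g u -> pairwise (fun i j => f j <= f i) u ->
  (forall vs1 v vs2, u = vs1 ++ v :: vs2 -> load f g vs1 (g v) <= L) ->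
  {in u, forall j, L / 2 < f j} ->
  exists h : 'I_k -> R * R,
    [/\ forall l, big_pair L (h l),
        forall l m, encloses (h l) (h m) || encloses (h m) (h l) &
        forall l, [seq f j | j <- u & g j == l] = nonzero_entries (h l)].
Proof.
move=> L0; elim/last_ind: u => [|u v IH] sched sorted bounded big.
  exists (fun=> (0, 0)); split=> [l|l m|l].
  - by rewrite /big_pair /= eqxx lexx.
  - by rewrite /encloses /= lexx.
  - by rewrite /nonzero_entries /= eqxx.
have load_ul := bounded u v [::] (esym (cats1 _ _)).
have load_um m : load f g u (g v) <= load f g u m.
  apply: (sched u v [::]); first by rewrite cats1.
  by have := big v; rewrite mem_rcons mem_head => /(_ isT); move: L0; lra.
move: sorted; rewrite -cats1 pairwise_cat => /and3P[/allrelP u_v sorted _].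
have {}u_v j : j \in u -> f v <= f j.
  by move=> ju; apply: u_v; rewrite ?mem_seq1.
rewrite -cats1 in sched bounded.
have fv : L / 2 < f v by apply: big; rewrite mem_rcons mem_head.
have [||||h [h_big h_enc hE]] := IH.
- exact: list_scheduled_prefix sched.
- by [].
- by move=> vs1 x vs2 uE; apply: (bounded vs1 x (vs2 ++ [:: v])); rewrite uE -catA.
- by move=> j ju; apply: big; rewrite mem_rcons inE ju orbT.
have loadE m : load f g u m = (h m).1 + (h m).2.
  by rewrite -sum_part_sizes hE sum_nonzero_entries.
have entry_ge m x : x \in nonzero_entries (h m) -> f v <= x.
  by rewrite -hE => /mapP[j]; rewrite mem_filter => /andP[_ /u_v] + ->.
(* Two big jobs exceed [L], so the part receiving [v] held at most one. *)
have hl2 : (h (g v)).2 = 0.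
  have := h_big (g v); rewrite /big_pair => /orP[/andP[/eqP //]|].
  by move: load_ul; rewrite loadE; move: L0; lra.
have hl1 : 0 <= (h (g v)).1.
  by have := h_big (g v); rewrite /big_pair hl2; case/orP; move: L0; lra.
have hl1_le m : (h (g v)).1 <= (h m).1 + (h m).2.
  by move: (load_um m); rewrite !loadE hl2 addr0.
pose c := if (h (g v)).1 == 0 then (f v, 0) else ((h (g v)).1, f v).
have fv_le : (h (g v)).1 != 0 -> f v <= (h (g v)).1.
  by move=> h0; apply: (entry_ge (g v)); rewrite mem_filter h0 mem_head.
have c_big : big_pair L c.
  rewrite /c /big_pair; case: ((h (g v)).1 =P 0) => [_|/eqP/fv_le h0] /=.
    by rewrite eqxx; lra.
  by rewrite fv h0; move: load_ul; rewrite loadE hl2 addr0 => ->; rewrite orbT.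
(* If [g v] held a job, a lone job elsewhere is at least as large, so its pair encloses [c]; a full
   [h m] was enclosed by [h (g v)] and stays enclosed by [c], as [f v] is smallest. If [g v] was
   empty, a full [h m] is impossible, not being nested with [(0, 0)]. *)
have c_enc m : m != g v -> encloses c (h m) || encloses (h m) c.
  move=> mv; have := h_enc (g v) m; have := h_big m.
  have := entry_ge m (h m).2; rewrite /c /encloses /big_pair hl2.
  rewrite mem_filter !inE eqxx orbT andbT.
  case: ((h (g v)).1 =P 0) => [->|/eqP/fv_le h0] /=.
    have [->|m2] := eqVneq (h m).2 0.
      by move=> _ _ _; rewrite lexx !andbT le_total.
    by move=> /= _ ? /orP[] ?; move: L0; lra.
  have [m2|m2] := eqVneq (h m).2 0 => /=.
    by move: (hl1_le m) L0; rewrite m2 => ? ? _ _ _;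
      apply/orP; right; apply/andP; split; lra.
  by move=> /(_ isT) ? ? ?; apply/orP; left; apply/andP; split; lra.
exists (fun m => if m == g v then c else h m); split=> [m|m p|m].
- by case: ifP.
- case: eqP => [_|/eqP mv]; case: eqP => [_|/eqP pv] //.
  + by rewrite /encloses !lexx.
  + exact: c_enc.
  + by rewrite orbC c_enc.
rewrite filter_cat map_cat hE /= [m == _]eq_sym.
case: (g v =P m) => [<-|_]; last by rewrite cats0.
rewrite /nonzero_entries hl2 /c.
have fv0 : f v != 0 by apply/eqP; move: L0 fv; lra.
by case: (eqVneq (h (g v)).1 0) => [->|h0] /=; rewrite ?eqxx ?fv0 ?h0.
Qed.

Lemma perm_flatten_parts (n k : nat) (g : 'I_n -> 'I_k) (u : seq 'I_n) :
  perm_eq (flatten [seq [seq j <- u | g j == l] | l <- enum 'I_k]) u.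
Proof.
apply/permP => a; rewrite count_flatten -map_comp sumnE big_map big_enum /=.
rewrite -sum1_count [RHS](partition_big g xpredT) //=; apply: eq_bigr => l _.
by rewrite count_filter -sum1_count; apply: eq_bigl => j /=.
Qed.

(** The pairs of [g] are mutually nested, so sorting them by [encloses] gives the chain for
    [fold_optimal]; the parts of [g'] are the competing lists. *)
Lemma big_jobs_optimal (R : realFieldType) (n k : nat) (f : 'I_n -> R)
    (g g' : 'I_n -> 'I_k) (G : R -> R) (L : R) (u : seq 'I_n) :
  spread_convex G -> 0 <= L -> list_scheduled f g u ->
  pairwise (fun i j => f j <= f i) u ->
  (forall vs1 v vs2, u = vs1 ++ v :: vs2 -> load f g vs1 (g v) <= L) ->
  {in u, forall j, L / 2 < f j} ->
  \sum_l G (load f g u l) <= \sum_l G (load f g' u l).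
Proof.
move=> cvx L0 sched sorted bounded big.
have [h [h_big h_enc hE]] := big_jobs_folded L0 sched sorted bounded big.
pose hs := [seq h l | l <- enum 'I_k].
pose sigma := sort (@encloses R) hs.
have sigma_perm : perm_eq sigma hs by rewrite perm_sort.
pose tau := [seq [seq f j | j <- u & g' j == l] | l <- enum 'I_k].
have -> : \sum_l G (load f g u l) = \sum_(c <- sigma) G (c.1 + c.2).
  rewrite (perm_big _ sigma_perm) big_map big_enum; apply: eq_bigr => l _.
  by rewrite -sum_part_sizes hE sum_nonzero_entries.
have -> : \sum_l G (load f g' u l) = \sum_(c <- tau) G (\sum_(x <- c) x).
  rewrite big_map big_enum; apply: eq_bigr => l _.
  by rewrite sum_part_sizes.
apply: (fold_optimal (L := L)) => //.
- rewrite (perm_all _ sigma_perm); apply/allP => c /mapP[l _ ->]; exact: h_big.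
- rewrite -sorted_pairwise.
    apply: (sort_sorted_in (P := mem hs)); last exact/allP.
    by move=> _ _ /mapP[l _ ->] /mapP[m _ ->].
  move=> y x z; rewrite /encloses => /andP[yx1 xy2] /andP[zy1 yz2].
  by rewrite (le_trans zy1) // (le_trans xy2).
- by rewrite (perm_size sigma_perm) !size_map.
have flatE (p : 'I_n -> 'I_k) :
    flatten [seq [seq f j | j <- u & p j == l] | l <- enum 'I_k] =
    map f (flatten [seq [seq j <- u | p j == l] | l <- enum 'I_k]).
  by rewrite map_flatten -map_comp.
apply: (@perm_trans _ (map f u)).
  by rewrite flatE perm_map // perm_flatten_parts.
rewrite perm_sym /pair_jobs (perm_trans (perm_flatten (perm_map _ sigma_perm))) //.
rewrite -map_comp.
under eq_map do rewrite /= -hE.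
by rewrite flatE perm_map // perm_flatten_parts.
Qed.

(** * The ratio 25/24 against any schedule *)

Lemma sum_load (R : realFieldType) (n k : nat) (f : 'I_n -> R)
    (g : 'I_n -> 'I_k) (u : seq 'I_n) :
  \sum_l load f g u l = \sum_(j <- u) f j.
Proof. by rewrite [RHS](partition_big g xpredT). Qed.

(** Isolates the job whose start Graham's argument examines; trailing zeros are skipped because
    [list_scheduled] does not constrain them. *)
Lemma load_last_positive (R : realFieldType) (n k : nat) (f : 'I_n -> R)
    (g : 'I_n -> 'I_k) (u : seq 'I_n) (l : 'I_k) :
  (forall i, 0 <= f i) -> 0 < load f g u l ->
  exists vs1 v vs2, [/\ u = vs1 ++ v :: vs2, g v = l, 0 < f v &
    load f g u l = load f g vs1 l + f v].
Proof.
move=> f0; elim/last_ind: u => [|u x IH]; first by rewrite /load big_nil ltxx.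
rewrite load_rcons; case: eqP => [gx|_].
  have [fx _|fx] := ltP 0 (f x); first by exists u, x, [::]; rewrite cats1.
  have -> : f x = 0 by apply/eqP; rewrite eq_le fx f0.
  rewrite addr0 => /IH[vs1 [v [vs2 [-> gv fv h]]]].
  by exists vs1, v, (rcons vs2 x); rewrite -rcons_cons rcons_cat.
rewrite addr0 => /IH[vs1 [v [vs2 [-> gv fv h]]]].
by exists vs1, v, (rcons vs2 x); rewrite -rcons_cons rcons_cat.
Qed.

(** Makes the big jobs a prefix, so that they form a list schedule themselves. *)
Lemma pairwise_threshold_split (R : realFieldType) (n : nat) (f : 'I_n -> R)
    (c : R) (u : seq 'I_n) :
  pairwise (fun i j => f j <= f i) u ->
  u = [seq j <- u | c < f j] ++ [seq j <- u | f j <= c].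
Proof.
elim: u => //= x u IH /andP[/allP x_u /IH uE].
case: (ltP c (f x)) => [_|xc] /=; first by rewrite -uE.
have small j : j \in u -> f j <= c by move=> /x_u /le_trans; apply.
have -> : [seq j <- u | c < f j] = [::].
  apply/eqP; rewrite -(negbK (_ == _)) -has_filter; apply/hasPn => j /small.
  by rewrite leNgt.
by congr (_ :: _); apply/esym/all_filterP/allP.
Qed.

(** A positive job starts on a least loaded part, and loads only grow afterwards. *)
Lemma list_scheduled_start (R : realFieldType) (n k : nat) (f : 'I_n -> R)
    (g : 'I_n -> 'I_k) (vs1 vs2 : seq 'I_n) (v : 'I_n) (m : 'I_k) :
  (forall i, 0 <= f i) -> list_scheduled f g (vs1 ++ v :: vs2) -> 0 < f v ->
  load f g vs1 (g v) <= load f g (vs1 ++ v :: vs2) m.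
Proof.
move=> f0 sched fv; apply: le_trans (sched _ _ _ m erefl fv) _.
by rewrite load_cat lerDl load_ge0.
Qed.

Lemma list_scheduled_sum_sqr (R : realFieldType) (n k : nat) (f : 'I_n -> R)
    (g g' : 'I_n -> 'I_k) (u : seq 'I_n) (l0 : 'I_k) :
  (forall i, 0 <= f i) -> list_scheduled f g u ->
  pairwise (fun i j => f j <= f i) u ->
  (forall m, load f g u l0 <= load f g u m) ->
  24 * \sum_l load f g u l ^+ 2 <= 25 * \sum_l load f g' u l ^+ 2.
Proof.
move=> f0 sched sorted.
set L := load f g u l0 => Lmin.
have L0 : 0 <= L by exact: load_ge0.
pose uB := [seq j <- u | L / 2 < f j].
have uE := pairwise_threshold_split (L / 2) sorted; rewrite -/uB in uE.
pose H l := 3 / 2 * L < load f g u l.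
have uB_le (p : 'I_n -> 'I_k) l : load f p uB l <= load f p u l.
  by rewrite [X in _ <= load _ _ X _]uE load_cat lerDl load_ge0.
(* The last positive job here starts at load at most [L], so it exceeds [L / 2], as do all jobs
   ahead of it. *)
have H_big l : H l -> load f g uB l = load f g u l.
  move=> Hl; apply/eqP; rewrite eq_le uB_le /=.
  have s_gt0 : 0 < load f g u l by move: Hl L0; rewrite /H; lra.
  have [vs1 [v [vs2 [vsE gv fv sE]]]] := load_last_positive f0 s_gt0.
  have startL : load f g vs1 l <= L.
    rewrite -gv /L; move: sched; rewrite vsE => sched.
    exact: list_scheduled_start.
  have v_big : L / 2 < f v by move: Hl; rewrite /H sE; lra.
  rewrite sE /uB vsE filter_cat load_cat /= v_big.
  have vs1B : [seq j <- vs1 | L / 2 < f j] = vs1.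
    apply/all_filterP/allP => j jvs1; apply: lt_le_trans v_big _.
    move: sorted; rewrite vsE pairwise_cat => /and3P[/allrelP h _ _].
    by apply: h => //; rewrite mem_head.
  rewrite vs1B lerD2l /load big_cons gv eqxx lerDl.
  exact: sumr_ge0.
pose N : R := (#|[pred l | ~~ H l]|)%:R.
have N0 : 0 < N.
  rewrite ltr0n; apply/card_gt0P; exists l0; rewrite inE -leNgt -/L.
  by move: L0; lra.
have sumN (c : R) : \sum_(l | ~~ H l) c = N * c.
  by rewrite sumr_const mulr_natl.
pose mu := (\sum_(l | ~~ H l) load f g u l) / N.
have TE : \sum_(l | ~~ H l) load f g u l = N * mu.
  by rewrite /mu mulrC divfK // gt_eqF.
have muL : mu <= 3 / 2 * L.
  rewrite ler_pdivrMr // mulrC -sumN; apply: ler_sum => l.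
  by rewrite -leNgt.
pose G := fun x : R => Num.max (x - mu) 0 ^+ 2.
have opt : \sum_l G (load f g uB l) <= \sum_l G (load f g' uB l).
  apply: (@big_jobs_optimal _ _ _ f g g' G L) => //.
  - exact: spread_convex_pos_sqr.
  - by move: sched; rewrite uE; exact: list_scheduled_prefix.
  - by move: sorted; rewrite uE pairwise_cat => /and3P[].
  - move=> vs1 v vs2 uBE; have vB : v \in uB by rewrite uBE mem_cat mem_head orbT.
    have fv : 0 < f v by move: vB; rewrite mem_filter => /andP[+ _]; move: L0; lra.
    move: sched; rewrite /L uE uBE -catA => sched.
    exact: list_scheduled_start.
  - by move=> j; rewrite mem_filter => /andP[].
(* This is [(y - mu)^2 >= G b] expanded, for a load [y] with big load [b]. The remaining terms are
   affine in [y], so their sum is the same for [g] and [g']. *)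
have tangent : \sum_l (G (load f g' uB l) + (2 * mu * load f g' u l - mu ^+ 2)) <=
    \sum_l load f g' u l ^+ 2.
  apply: ler_sum => l _; have := uB_le g' l; have := load_ge0 g' uB l f0.
  rewrite /G /Num.max; case: ltP => h b0 /= by_; last by nra.
  by have := sqr_ge0 (load f g' u l - mu); nra.
have H_le : \sum_(l | H l) (load f g u l - mu) ^+ 2 <= \sum_l G (load f g uB l).
  rewrite [leRHS](bigID H) /= -[leLHS]addr0 lerD //.
    apply: ler_sum => l Hl; rewrite H_big // /G /Num.max.
    by case: ltP => //; move: Hl muL; rewrite /H; lra.
  by apply: sumr_ge0 => l _; exact: sqr_ge0.
have sumE : \sum_l (2 * mu * load f g' u l - mu ^+ 2) =
    \sum_l (2 * mu * load f g u l - mu ^+ 2).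
  by rewrite !sumrB -!mulr_sumr !sum_load.
rewrite big_split /= sumE [X in _ + X <= _](bigID H) /= in tangent.
have notH : \sum_(l | ~~ H l) (2 * mu * load f g u l - mu ^+ 2) = N * mu ^+ 2.
  by rewrite sumrB -mulr_sumr TE sumN; ring.
have Hsqr : \sum_(l | H l) (load f g u l - mu) ^+ 2 +
    \sum_(l | H l) (2 * mu * load f g u l - mu ^+ 2) =
    \sum_(l | H l) load f g u l ^+ 2.
  by rewrite -big_split; apply: eq_bigr => l _ /=; ring.
have Hsqr0 : 0 <= \sum_(l | H l) load f g u l ^+ 2.
  by apply: sumr_ge0 => l _; exact: sqr_ge0.
(* Expands [(s - L)(s - 3L/2) <= 0]. *)
have notH_le : \sum_(l | ~~ H l) load f g u l ^+ 2 <=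
    \sum_(l | ~~ H l) (5 / 2 * L * load f g u l - 3 / 2 * L ^+ 2).
  apply: ler_sum => l; rewrite /H -leNgt => Hl.
  by have := Lmin l; nra.
rewrite sumrB -mulr_sumr TE sumN in notH_le.
(* Source of 25/24: [25/24 mu^2 - (5/2 L mu - 3/2 L^2)] equals [(5 mu - 6 L)^2 / 24]. *)
have amgm : 0 <= N * (5 * mu - 6 * L) ^+ 2 by rewrite mulr_ge0 ?sqr_ge0 // ltW.
rewrite (bigID H) /=; nra.
Qed.

(** * The ratio 37/36 against equal loads *)

Lemma load_filter (R : realFieldType) (n k : nat) (f : 'I_n -> R)
    (g : 'I_n -> 'I_k) (u : seq 'I_n) (l : 'I_k) :
  load f g u l = \sum_(j <- [seq j <- u | g j == l]) f j.
Proof. by rewrite big_filter. Qed.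

Lemma load_ge_count (R : realFieldType) (n k : nat) (f : 'I_n -> R)
    (g : 'I_n -> 'I_k) (u : seq 'I_n) (l : 'I_k) (c : R) :
  {in u, forall j, c <= f j} ->
  (size [seq j <- u | g j == l])%:R * c <= load f g u l.
Proof.
move=> hc; rewrite load_filter mulr_natl -iter_addr_0 -count_predT -big_const_seq.
rewrite big_seq [leRHS]big_seq; apply: ler_sum => j.
by rewrite mem_filter => /andP[_ /hc].
Qed.

(* Were [v] the first big job to overflow, every part would already hold one or
   two big jobs. A job alone in its part is too large to share a part with
   another big job in a feasible partition; counting such jobs twice, the jobs
   before [v] have total weight [2 k], while no feasible part has weight above 2. *)
Lemma big_jobs_no_overflow (R : realFieldType) (n k : nat) (f : 'I_n -> R)
    (g g' : 'I_n -> 'I_k) (u vs1 vs2 : seq 'I_n) (v : 'I_n) (C : R) :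
  (forall i, 0 <= f i) -> list_scheduled f g u ->
  pairwise (fun i j => f j <= f i) u ->
  (forall l, load f g' u l <= C) ->
  u = vs1 ++ v :: vs2 -> C / 3 < f v -> load f g vs1 (g v) + f v <= C.
Proof.
move=> f0 sched sorted feas.
have [N] := ubnP (size vs1); elim: N vs1 v vs2 => // N IH vs1 v vs2.
rewrite ltnS => vs1N uE fv.
rewrite leNgt; apply/negP => overflow.
have C0 : 0 <= C by apply: le_trans (feas (g v)); exact: load_ge0.
have fv0 : 0 < f v by move: fv C0; lra.
have load_gt m : C < load f g vs1 m + f v.
  by apply: lt_le_trans overflow _; rewrite lerD2r; exact: sched uE fv0.
have vs1_ge j : j \in vs1 -> f v <= f j.
  move: sorted; rewrite uE pairwise_cat => /and3P[/allrelP h _ _] jvs1.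
  by apply: h => //; rewrite mem_head.
have feas1 m : load f g' vs1 m + (if g' v == m then f v else 0) <= C.
  apply: le_trans (feas m); rewrite -load_rcons uE -cat_rcons load_cat lerDl.
  exact: load_ge0.
have fvC : f v <= C.
  by move: (feas1 (g' v)); rewrite eqxx; have := load_ge0 g' vs1 (g' v) f0; lra.
(* The jobs before [v] are at least as large, so by induction none of them overflowed. *)
have load_le m : load f g vs1 m <= C.
  have [h|h] := ltP 0 (load f g vs1 m); last exact: le_trans h C0.
  have [a [i [b [vs1E gi fi ->]]]] := load_last_positive f0 h.
  rewrite -gi; apply: (IH a i (b ++ v :: vs2)).
  - by apply: leq_trans vs1N; rewrite vs1E size_cat /= addnS ltnS leq_addr.
  - by rewrite uE vs1E -catA.
  - by apply: lt_le_trans fv (vs1_ge _ _); rewrite vs1E mem_cat mem_head orbT.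
pose part m := [seq j <- vs1 | g j == m].
have part_size m : (0 < size (part m) <= 2)%N.
  apply/andP; split.
    rewrite lt0n size_eq0; apply/eqP => part0.
    by have := load_gt m; rewrite load_filter -/(part m) part0 big_nil; lra.
  rewrite leqNgt; apply/negP => part3.
  have := load_ge_count g m vs1_ge; rewrite -/(part m).
  have : 3 <= (size (part m))%:R :> R by rewrite ler_nat.
  by move: (load_le m) fv; nra.
pose wt j := (if size (part (g j)) == 1 then 2 else 1)%N.
have wt_le2 j : (wt j <= 2)%N by rewrite /wt; case: eqP.
(* A job alone in its part overflows together with [v], hence with any [x] at least [f v]. *)
have wt1 j x : j \in vs1 -> f j + x <= C -> f v <= x -> wt j = 1%N.
  move=> jvs1 jx vx; rewrite /wt; case: eqP => // part1.
  have : j \in part (g j) by rewrite mem_filter eqxx.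
  have := load_gt (g j); rewrite load_filter -/(part _).
  case: (part (g j)) part1 => [|y [|//]] // _; rewrite big_seq1 => h.
  by rewrite mem_seq1 => /eqP jy; exfalso; move: h; rewrite -jy; lra.
have total : (\sum_(j <- vs1) wt j = \sum_(m < k) 2)%N.
  rewrite (partition_big g xpredT) //=; apply: eq_bigr => m _.
  rewrite (eq_bigr (fun=> if size (part m) == 1 then 2 else 1)%N); last first.
    by move=> j /eqP gj; rewrite /wt gj.
  rewrite big_const_seq -size_filter -/(part m) iter_addn_0.
  by have := part_size m; case: (size (part m)) => [|[|[|]]].
(* Counting [v] itself with weight 1 gives [2 k + 1], one more than the feasible parts can hold. *)
have total' : (\sum_(m < k) (\sum_(j <- vs1 | g' j == m) wt j + (g' v == m)) =
    \sum_(m < k) 2 + 1)%N.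
  rewrite big_split /= -total; congr (_ + _)%N.
    by rewrite [RHS](partition_big g' xpredT).
  by rewrite (bigD1 (g' v)) //= eqxx big1 // => m /negPf; rewrite eq_sym => ->.
suff : (\sum_(m < k) (\sum_(j <- vs1 | g' j == m) wt j + (g' v == m)) <=
    \sum_(m < k) 2)%N by rewrite total' addn1 ltnn.
apply: leq_sum => m _.
rewrite -big_filter; set P := [seq j <- vs1 | g' j == m].
have P_vs1 j : j \in P -> j \in vs1 by rewrite mem_filter => /andP[].
have P_size := load_ge_count g' m vs1_ge; rewrite -/P in P_size.
have := feas1 m; rewrite [load _ _ _ _]load_filter -/P in P_size *.
case: eqP => _ /= hC.
  case: P P_vs1 P_size hC => [|x [|y P]] P_vs1 P_size hC.
  - by rewrite big_nil.
  - rewrite big_seq1 in hC; rewrite big_seq1 (wt1 x (f v)) //.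
    by apply: P_vs1; rewrite mem_head.
  - have : 2 <= (size [:: x, y & P])%:R :> R by rewrite ler_nat.
    by move: P_size hC fv; nra.
rewrite addr0 in hC; rewrite addn0.
case: P P_vs1 P_size hC => [|x [|y [|z P]]] P_vs1 P_size hC.
- by rewrite big_nil.
- by rewrite big_seq1.
- rewrite big_cons big_seq1 in hC; rewrite big_cons big_seq1.
  have xP : x \in vs1 by apply: P_vs1; rewrite mem_head.
  have yP : y \in vs1 by apply: P_vs1; rewrite !inE eqxx orbT.
  by rewrite (wt1 x (f y)) ?(wt1 y (f x)) ?vs1_ge // addrC.
- have : 3 <= (size [:: x, y, z & P])%:R :> R by rewrite ler_nat.
  by move: P_size hC fv; nra.
Qed.

Lemma list_scheduled_sum_sqr_balanced (R : realFieldType) (n k : nat)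
    (f : 'I_n -> R) (g g' : 'I_n -> 'I_k) (u : seq 'I_n) (l0 : 'I_k) (C : R) :
  (forall i, 0 <= f i) -> list_scheduled f g u ->
  pairwise (fun i j => f j <= f i) u ->
  (forall m, load f g u l0 <= load f g u m) ->
  (forall m, load f g' u m = C) ->
  36 * \sum_l load f g u l ^+ 2 <= 37 * \sum_l load f g' u l ^+ 2.
Proof.
move=> f0 sched sorted; set L := load f g u l0 => Lmin bal.
have C0 : 0 <= C by rewrite -(bal l0) load_ge0.
have L0 : 0 <= L by exact: load_ge0.
pose M := Num.max C (L + C / 3).
have load_le l : load f g u l <= M.
  rewrite le_max; have [h|h] := ltP 0 (load f g u l); last by rewrite (le_trans h).
  have [vs1 [v [vs2 [vsE gv fv ->]]]] := load_last_positive f0 h.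
  rewrite -gv; have [vC|vC] := leP (f v) (C / 3).
    apply/orP; right; apply: lerD => //.
    rewrite /L; move: sched; rewrite vsE => sched.
    exact: list_scheduled_start.
  apply/orP; left; apply: (big_jobs_no_overflow (g' := g')) vsE vC => // l'.
  by rewrite bal.
have sumC : \sum_l load f g u l = k%:R * C.
  rewrite sum_load -(sum_load f g') (eq_bigr (fun=> C)) //.
  by rewrite sumr_const card_ord mulr_natl.
have k0 : 0 < k%:R :> R by rewrite ltr0n (leq_trans _ (ltn_ord l0)).
have LC : L <= C.
  rewrite -(ler_pM2l k0) -sumC mulr_natl -[X in _ *+ X]card_ord -sumr_const.
  exact: ler_sum.
have sqr_le : \sum_l load f g u l ^+ 2 <= \sum_l ((L + M) * load f g u l - L * M).
  apply: ler_sum => l _; have := Lmin l; have := load_le l; nra.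
rewrite sumrB -mulr_sumr sumC sumr_const card_ord -[_ *+ k]mulr_natl in sqr_le.
rewrite [X in _ <= 37 * X](eq_bigr (fun=> C ^+ 2)); last by move=> l _; rewrite bal.
rewrite sumr_const card_ord -[_ *+ k]mulr_natl.
(* When [M] is [L + C / 3], the two factors sum to [C / 3], so their product is at most
   [(C / 6)^2]. *)
have amgm : (C - L) * (M - C) <= C ^+ 2 / 36.
  rewrite /M; case: (leP C (L + C / 3)) => _.
    by have := sqr_ge0 (C - L - C / 6); nra.
  by rewrite subrr mulr0; have := sqr_ge0 C; lra.
by move: (ler_wpM2l (ltW k0) amgm) sqr_le; lra.
Qed.

(** * From partitions and cuts to loads *)

Lemma kpartition_assignment (n k : nat) (l0 : 'I_k) (A : parts n k) :
  kpartition A -> exists g : 'I_n -> 'I_k, forall l j, (j \in A l) = (g j == l).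
Proof.
move=> /andP[/forallP disj /eqP cover].
have ex j : exists l, j \in A l.
  have : j \in \bigcup_(l < k) A l by rewrite cover inE.
  by case/bigcupP=> l _ jl; exists l.
(* The default [l0] is never taken, since the parts cover every vertex. *)
exists (fun j => odflt l0 [pick l | j \in A l]) => l j.
case: pickP => [m jm|none] /=; last by have [m] := ex j; rewrite none.
have [<- //|ml] := eqVneq m l.
have := implyP (forallP (disj m) l) ml.
by rewrite disjoints_subset => /subsetP/(_ j jm); rewrite inE => /negPf.
Qed.

Lemma sum_part_load (R : realFieldType) (n k : nat) (f : 'I_n -> R)
    (A : parts n k) (g : 'I_n -> 'I_k) (vs : seq 'I_n) (l : 'I_k) :
  perm_eq vs (enum 'I_n) -> (forall l j, (j \in A l) = (g j == l)) ->
  \sum_(i in A l) f i = load f g vs l.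
Proof.
move=> vsP gA; rewrite /load (perm_big _ vsP) big_enum_cond /=.
exact: eq_bigl.
Qed.

(** In the expanded square of the total, each product of distinct parts occurs twice. Disjointness
    excludes [i = j], where [w] is unconstrained. *)
Lemma cut_Phi (R : realType) (n k : nat) (w : 'M[R]_n) (f : 'I_n -> R)
    (A : parts n k) (g : 'I_n -> 'I_k) :
  rank1_feature_graph w f -> (forall l j, (j \in A l) = (g j == l)) ->
  cut w A = ((\sum_i f i) ^+ 2 - Phi f A) / 2.
Proof.
move=> wf gA.
pose s l := \sum_(i in A l) f i.
have cutE : cut w A = \sum_(l < k) \sum_(m < k | (l < m)%N) s l * s m.
  apply: eq_bigr => l _; apply: eq_bigr => m lm.
  rewrite /s big_distrl; apply: eq_bigr => i il; rewrite big_distrr.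
  apply: eq_bigr => j jm; apply: wf; apply: contraTneq il => ->.
  move: jm; rewrite !gA => /eqP ->; rewrite -val_eqE /=.
  by rewrite gtn_eqF.
have sumE : \sum_i f i = \sum_l s l.
  rewrite (partition_big g xpredT) //=; apply: eq_bigr => l _.
  by apply: eq_bigl => j; rewrite gA.
have flip : \sum_(l < k) \sum_(m < k | (m < l)%N) s l * s m = cut w A.
  rewrite cutE (exchange_big_dep xpredT) //=.
  by apply: eq_bigr => l _; apply: eq_bigr => m _; rewrite mulrC.
have : (\sum_i f i) ^+ 2 = cut w A + cut w A + Phi f A.
  rewrite sumE expr2 big_distrl /= -{2}flip cutE /Phi -!big_split.
  apply: eq_bigr => l _ /=; rewrite big_distrr /= (bigD1 l) //= -expr2 addrC.
  congr (_ + _); rewrite (bigID (fun m : 'I_k => (l < m)%N)) /=.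
  congr (_ + _); apply: eq_bigl => m; rewrite -val_eqE /=.
    by case: ltngtP.
  by case: ltngtP.
by lra.
Qed.

Theorem mainTheorem8 (R : realType) (n k : nat) (hk : (2 <= k)%N)
    (hkn : (k < n)%N) (w : 'M[R]_n) (f : 'I_n -> R)
    (hG : rank1_feature_graph w f)
    (hw : forall i j : 'I_n, i != j -> 0 <= w i j)
    (hf : forall i : 'I_n, 0 <= f i)
    (ALG : parts n k) (hALG : greedy_output f ALG) :
  max_kcut k w - cut w ALG <= 1 / 50 * Phi f ALG /\
  ((exists B : parts n k, perfectly_balanced f B) ->
   max_kcut k w - cut w ALG <= 1 / 74 * Phi f ALG).
Proof.
have l1 : 'I_k by exact: Ordinal hk.
have [vs [g [vsP sorted sched gA]]] := greedy_output_assignment l1 hf hALG.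
have [l0 Lmin] : exists l0, forall m, load f g vs l0 <= load f g vs m.
  case: (arg_minP (fun l => load f g vs l) (erefl : xpredT l1)) => l0 _ h.
  by exists l0 => m; exact: h.
have PhiE (A : parts n k) p : (forall l j, (j \in A l) = (p j == l)) ->
    Phi f A = \sum_l load f p vs l ^+ 2.
  by move=> pA; apply: eq_bigr => l _; rewrite (sum_part_load _ _ vsP pA).
have Phi0 : 0 <= Phi f ALG by apply: sumr_ge0 => l _; exact: sqr_ge0.
(* The maximum in [max_kcut] starts from 0, which must obey the bound too. *)
have cut0 : 0 <= cut w ALG.
  apply: sumr_ge0 => l _; apply: sumr_ge0 => m lm; apply: sumr_ge0 => i il.
  apply: sumr_ge0 => j jm; apply: hw; apply: contraTneq il => ->.
  by move: jm; rewrite !gA => /eqP ->; rewrite -val_eqE /= gtn_eqF.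
(* The cut difference is half the [Phi] difference; [c = 1/50] and [c = 1/74] turn [1 - 2 * c] into
   24/25 and 36/37. *)
have reduce c : 0 <= c ->
    (forall B : parts n k, kpartition B -> (1 - 2 * c) * Phi f ALG <= Phi f B) ->
    max_kcut k w - cut w ALG <= c * Phi f ALG.
  move=> c0 hB; rewrite lerBlDr; apply: bigmax_le => [|B PB].
    by rewrite addr_ge0 // mulr_ge0.
  have [p pB] := kpartition_assignment l1 PB.
  rewrite (cut_Phi hG gA) (cut_Phi hG pB); have := hB B PB; lra.
split=> [|[B [PB balB]]]; apply: reduce; rewrite ?divr_ge0 // => A PA.
  have [p pA] := kpartition_assignment l1 PA.
  rewrite (PhiE _ _ gA) (PhiE _ _ pA).
  by have := list_scheduled_sum_sqr p hf sched sorted Lmin; lra.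
have [p pB] := kpartition_assignment l1 PB.
have bal m : load f p vs m = load f p vs l0.
  by rewrite -!(sum_part_load _ _ vsP pB).
have := list_scheduled_sum_sqr_balanced hf sched sorted Lmin bal.
rewrite -(PhiE _ _ gA) -(PhiE _ _ pB).
(* The ratio was obtained against [B]. Equal loads minimize [Phi], by the tangent bound
   [x^2 >= 2 C x - C^2] at the common load [C]. *)
suff : Phi f B <= Phi f A by lra.
rewrite /Phi.
pose C := \sum_(i in B l0) f i.
have sumf (D : parts n k) : kpartition D ->
    \sum_l \sum_(i in D l) f i = \sum_(i <- vs) f i.
  move=> /(kpartition_assignment l1)[q qD]; rewrite -(sum_load f q).
  by apply: eq_bigr => l _; rewrite (sum_part_load _ _ vsP qD).
have : \sum_l (2 * C * \sum_(i in A l) f i - C ^+ 2) <= Phi f A.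
  by apply: ler_sum => l _; have := sqr_ge0 (\sum_(i in A l) f i - C); nra.
apply: le_trans; rewrite sumrB -mulr_sumr sumf // -(sumf B) // mulr_sumr -sumrB.
by apply: ler_sum => l _; rewrite (balB l l0) -/C; nra.
Qed.
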